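(* Let $n \in \mathbb{N}$ and $m \in \mathbb{Z}$ with $0 \le m \le n-1$. Then there exists a constant $C_{n,m} > 0$ with the following property: for every $k \in \mathbb{N}$ and every function $F \colon \mathcal{K}_k^n \to \mathbb{Z}^{n-1}$ such that $\|F(K_1) - F(K_2)\|_\infty \le 1$ for all $K_1, K_2 \in \mathcal{K}_k^n$ with $\dim(K_1 \cap K_2) \ge m$, there exist a $1$-connected subset $P \subset \mathbb{Z}^{n-1}$ with $|P| \le C_{n,m}$ and a subfamily $\mathcal{S} \subset F^{-1}[P]$ such that $\bigcup \mathcal{S}$ connects some opposite faces of $I^n$.
   Context: $I^n = [0,1]^n$. For $n,k \in \mathbb{N}$, $\mathcal{K}_k^n = \{\prod_{s=1}^n [\frac{i_s-1}{k}, \frac{i_s}{k}] : i_s \in \{1,\dots,k\}\}$ is the division of $I^n$ into $k^n$ closed cubes. $\dim$ denotes topological dimension (so for two cubes of $\mathcal{K}_k^n$, $\dim(K_1\cap K_2)\ge 0$ means $K_1 \cap K_2 \neq \emptyset$, and $\dim(K_1 \cap K_2)$ is the dimension of their common face). For $i \in \{1,\dots,n\}$ the $i$th opposite faces of $I^n$ are $I^n_{i,-} = \{z \in I^n : z_i = 0\}$ and $I^n_{i,+} = \{z \in I^n : z_i = 1\}$. A set $S \subset I^n$ connects the $i$th opposite faces of $I^n$ if $S$ is connected and $S \cap I^n_{i,-} \ne \emptyset \ne S \cap I^n_{i,+}$; it connects some opposite faces if this holds for some $i$. $\mathbb{Z}^0 = \{0\}$, and $\mathbb{Z}^{n-1}$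 carries the $\ell^\infty$ norm. For $r>0$, a set $P$ in a metric space is $r$-connected if any two of its points $x,y$ can be joined by a finite sequence $x=p_1,\dots,p_N=y$ of points of $P$ with consecutive distances at most $r$. For $P \subset \mathbb{Z}^{n-1}$, $F^{-1}[P]$ denotes the preimage, a subfamily of $\mathcal{K}_k^n$. *)

(* Defs.v *)
From HB Require Import structures.
From mathcomp Require Import all_boot all_order all_algebra.
From mathcomp Require Import all_classical all_reals all_analysis.
Set Implicit Arguments. Unset Strict Implicit. Unset Printing Implicit Defensive.
Import numFieldTopology.Exports numFieldNormedType.Exports.
Import Order.TTheory GRing.Theory Num.Theory.
Local Open Scope classical_set_scope.
Local Open Scope ring_scope.

(* A cube of K_k^n is indexed by (i_1 - 1, ..., i_n - 1), i.e. by a finite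
   function i : 'I_n -> 'I_k (0-based indices). *)
Definition cube_index (n k : nat) := {ffun 'I_n -> 'I_k}.

Definition cube (R : realType) (n k : nat) (K : cube_index n k) : set 'M[R]_(1, n) :=
  [set z | forall s : 'I_n,
      (nat_of_ord (K s))%:R / k%:R <= z ord0 s /\ z ord0 s <= (K s).+1%:R / k%:R].

(* dim(K1 ∩ K2) >= m : the intersection is nonempty and its common face
   has dimension >= m; the dimension of the common face of two intersecting
   grid cubes is the number of coordinates in which their indices agree. *)
Definition meet_dim_ge (R : realType) (n k m : nat) (K1 K2 : cube_index n k) : Prop :=
  (@cube R n k K1 `&` @cube R n k K2 !=set0) /\ (m <= #|[set s : 'I_n | K1 s == K2 s]|)%N.

Definition Zpt (n : nat) := {ffun 'I_n.-1 -> int}.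
Definition linf_le1 (n : nat) (a b : Zpt n) : bool :=
  [forall j, `|a j - b j| <= 1].

(* P (finite, given as a duplicate-free list) is 1-connected *)
Definition one_connected (n : nat) (P : seq (Zpt n)) : Prop :=
  forall x y, x \in P -> y \in P ->
    exists p : seq (Zpt n),
      [/\ path (@linf_le1 n) x p, last x p = y & all (fun q => q \in P) p].

Definition connects_opposite_faces (R : realType) (n : nat) (S : set 'M[R]_(1, n)) : Prop :=
  connected S /\
  exists i : 'I_n, (exists z, S z /\ z ord0 i = 0) /\ (exists z, S z /\ z ord0 i = 1).

Definition union_cubes (R : realType) (n k : nat) (S : {set cube_index n k}) : set 'M[R]_(1, n) :=
  [set z | exists K, K \in S /\ @cube R n k K z].

(* Main.v *)
(* Colour [z : Zpt n] by some [c < n] such that no coordinate of [z] lies in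
   [c n, (c+1) n) modulo n^2; one exists because there are n-1 coordinates and n
   colours.  [F] moves by at most n between touching cubes, so along a chain of
   touching cubes [K] for which [F K] has colour c, no coordinate of [F K] can jump
   over a forbidden interval: [F K] stays in a translate of [0, n^2)^(n-1), whence
   C = (n^2)^(n-1).  By the n-dimensional Hex (Steinhaus chessboard) theorem one of
   the n colours contains a chain joining opposite faces.

   Hex follows from a discrete Poincare-Miranda theorem for 0/1-valued functions
   [a_i] of the grid vertices: let [a_i] vanish on the face x_i = 0 and at the
   corners of the i-coloured cubes joined to that face.  If no chain of colour i
   reaches x_i = k, then [a_i] = 1 there, but [a_c] is constant on every cube of
   colour c.  Poincare-Miranda is proved with the mod 2 cup product of the
   coboundaries of the [a_i]: it is exact, so its sum over all cubes reduces,
   dimension by dimension, to 1. *)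
Require Import Defs.
From HB Require Import structures.
From mathcomp Require Import all_boot all_order all_algebra.
From mathcomp Require Import boolp.
From mathcomp Require Import zify ring lra.
Set Implicit Arguments. Unset Strict Implicit. Unset Printing Implicit Defensive.
Import Order.TTheory GRing.Theory Num.Theory.
Local Open Scope ring_scope.

(** * Cochains mod 2 on the grid and their cup product *)

Lemma addFF (x : 'F_2) : x + x = 0.
Proof. by case: x => [[|[|?]] //= ?]; apply/val_inj. Qed.

Lemma addF_eq0 (x y : 'F_2) : x + y = 0 -> x = y.
Proof. by move=> h; rewrite -[x]addr0 -(addFF y) addrA h add0r. Qed.

(** The terms for (s, t) and (t, s) cancel in characteristic 2; this is what makes the coboundary
    square to zero in [cobdK]. *)
Lemma sum_sym0 (I : finType) (E : {set I}) (f : I -> I -> 'F_2) :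
  (forall s t, f s t = f t s) ->
  \sum_(s in E) \sum_(t in E :\ s) f s t = 0.
Proof.
move=> fC; pose r (s t : I) := (enum_rank s < enum_rank t)%N.
have -> : \sum_(s in E) \sum_(t in E :\ s) f s t =
    \sum_(s in E) \sum_(t in E | r s t) f s t +
    \sum_(s in E) \sum_(t in E | r t s) f s t.
  rewrite -big_split /=; apply: eq_bigr => s _.
  rewrite (bigID (r s)) /=; congr (_ + _); apply: eq_bigl => t;
    rewrite !inE /r -(inj_eq enum_rank_inj) -(inj_eq val_inj) /=;
    by case: ltngtP; rewrite ?andbT ?andbF.
rewrite [X in _ + X](exchange_big_dep (mem E)) //=; last by move=> s t _ /andP[].
rewrite [X in _ + X](_ : _ = \sum_(s in E) \sum_(t in E | r s t) f s t) ?addFF //.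
apply: eq_bigr => t tE; apply: eq_big => [s|s _]; last exact: fC.
by rewrite tE.
Qed.

Section Cup.
Variables (n : nat) (a : nat -> {ffun 'I_n -> nat} -> 'F_2).
Implicit Types (x : {ffun 'I_n -> nat}) (E : {set 'I_n}).

Definition corner x E : {ffun 'I_n -> nat} := [ffun s => (x s + (s \in E))%N].

(* The cup product of the coboundaries of [a 0], ..., [a (m - 1)], evaluated on the
   cube with lowest corner [x] and edge directions [E] (used when #|E| = m). *)
Fixpoint cup m x E : 'F_2 :=
  if m is m'.+1 then
    \sum_(s in E) cup m' x (E :\ s) * (a m' (corner x E) + a m' (corner x (E :\ s)))
  else 1.

(* The cup product of [cup m] with the 0-cochain [a m]: a primitive of [cup m.+1]. *)
Definition pcup m x E := cup m x E * a m (corner x E).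

Definition cobd (g : {ffun 'I_n -> nat} -> {set 'I_n} -> 'F_2) x E :=
  \sum_(s in E) (g (corner x [set s]) (E :\ s) + g x (E :\ s)).

Lemma corner_corner x s E : s \in E -> corner (corner x [set s]) (E :\ s) = corner x E.
Proof.
move=> sE; apply/ffunP => t; rewrite !ffunE !inE.
by case: eqP => [->|_] /=; rewrite ?sE ?addn0.
Qed.

Lemma corner1C x s t : corner (corner x [set s]) [set t] = corner (corner x [set t]) [set s].
Proof. by apply/ffunP => u; rewrite !ffunE addnAC. Qed.

Lemma corner0 x : corner x set0 = x.
Proof. by apply/ffunP => u; rewrite !ffunE inE addn0. Qed.

Lemma cobdK g x E : cobd (cobd g) x E = 0.
Proof.
rewrite /cobd.
under eq_bigr => s _ do rewrite -big_split /=.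
apply: sum_sym0 => s t; rewrite corner1C !setDDl setUC.
set p := g _ _; set q := g _ _; set u := g _ _; set v := g _ _.
by ring.
Qed.

(** The two claims feed each other: closedness of [cup m] yields the primitive of [cup m.+1], and
    exactness of [cup m.+1] yields its closedness by [cobdK]. *)
Lemma cup_closed m :
  (forall x E, cobd (cup m) x E = 0) /\ (forall x E, cup m.+1 x E = cobd (pcup m) x E).
Proof.
have step : forall m, (forall x E, cobd (cup m) x E = 0) ->
    forall x E, cup m.+1 x E = cobd (pcup m) x E.
  (* By closedness, [cup m] has the same sum over the facets through [x] as over the opposite
     facets; the latter all share the top corner [corner x E]. *)
  move=> {}m cl x E; have := cl x E; rewrite /cobd big_split /= => /addF_eq0 e.
  under eq_bigr => s _ do rewrite mulrDr.
  rewrite big_split /= -mulr_suml -e mulr_suml -big_split /=.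
  by apply: eq_bigr => s sE; rewrite /pcup corner_corner.
elim: m => [|m [cl e]].
  have cl0 : forall x E, cobd (cup 0) x E = 0.
    by move=> x E; apply: big1 => s _; rewrite /= addFF.
  by split=> //; apply: step.
have cl1 : forall x E, cobd (cup m.+1) x E = 0.
  move=> x E; rewrite -[RHS](cobdK (pcup m) x E).
  by apply: eq_bigr => s _; rewrite !e.
by split=> //; apply: step.
Qed.

(** [a i] enters the product only through differences of its values at corners of the cube. *)
Lemma cup_const m i c x E : (i < m)%N ->
  (forall E' : {set 'I_n}, E' \subset E -> a i (corner x E') = c) -> cup m x E = 0.
Proof.
elim: m E => // m IH E; rewrite ltnS leq_eqVlt => lt_i ac /=.
apply: big1 => s sE; case/orP: lt_i => [/eqP <-|lt_i].
  by rewrite !ac ?subD1set // addFF mulr0.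
rewrite IH ?mul0r // => E' sE'; apply: ac.
exact: subset_trans sE' (subD1set _ _).
Qed.

End Cup.

Lemma sum_telescope (n k : nat) (s : 'I_n) (P : pred {ffun 'I_n -> 'I_k.+1})
    (g : {ffun 'I_n -> nat} -> 'F_2) :
  (forall x y : {ffun 'I_n -> 'I_k.+1}, (forall t, t != s -> x t = y t) -> P x = P y) ->
  let nx (x : {ffun 'I_n -> 'I_k.+1}) : {ffun 'I_n -> nat} := [ffun t => x t : nat] in
  \sum_(x | P x && (x s < k)%N) (g (corner (nx x) [set s]) + g (nx x)) =
  \sum_(x | P x && (x s == k :> nat)) g (nx x) +
  \sum_(x | P x && (x s == 0 :> nat)) g (nx x).
Proof.
move=> Ps nx.
(* Cyclic shifts in direction [s] are bijective; k wraps around to 0, so the condition x_s < k turns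
   into x_s != 0. *)
pose up (x : {ffun 'I_n -> 'I_k.+1}) := [ffun t => if t == s then ordS (x t) else x t].
pose dn (x : {ffun 'I_n -> 'I_k.+1}) := [ffun t => if t == s then ord_pred (x t) else x t].
have upK : cancel up dn.
  by move=> x; apply/ffunP => t; rewrite !ffunE; case: eqP => // _; rewrite ordSK.
have dnK : cancel dn up.
  by move=> x; apply/ffunP => t; rewrite !ffunE; case: eqP => // _; rewrite ord_predK.
have Pup x : P (up x) = P x.
  by apply: Ps => t ts; rewrite ffunE (negPf ts).
have e1 : \sum_(x | P x && (x s < k)%N) g (corner (nx x) [set s]) =
          \sum_(x | P x && (x s != 0 :> nat)) g (nx x).
  rewrite [RHS](reindex up) /=; last by exists dn => x _; [apply: upK|apply: dnK].
  apply: eq_big => [x|x /andP[_ xs]].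
    rewrite Pup ffunE eqxx /=; congr (_ && _).
    have := ltn_ord (x s); rewrite ltnS leq_eqVlt => /orP[/eqP ->|lt].
      by rewrite ltnn modnn.
    by rewrite lt modn_small.
  congr g; apply/ffunP => t; rewrite !ffunE inE; case: eqP => [->|_].
    by rewrite /= modn_small // addn1.
  by rewrite addn0.
rewrite big_split /= e1; apply: addF_eq0.
set A := \sum_(x | P x && (x s != 0 :> nat)) _.
set B := \sum_(x | P x && (x s < k)%N) _; set Ck := \sum_(x | P x && (x s == k :> nat)) _.
set Z := \sum_(x | _) _.
have eA : Z + A = \sum_(x | P x) g (nx x).
  by rewrite [RHS](bigID (fun x : {ffun 'I_n -> 'I_k.+1} => x s == 0 :> nat)).
have eB : Ck + B = \sum_(x | P x) g (nx x).
  rewrite [RHS](bigID (fun x : {ffun 'I_n -> 'I_k.+1} => x s == k :> nat)) /=.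
  congr (_ + _); apply: eq_bigl => x; congr (_ && _).
  by have := ltn_ord (x s); rewrite ltnS; case: ltngtP.
have -> : A + B + (Ck + Z) = (Z + A) + (Ck + B) by ring.
by rewrite eA eB addFF.
Qed.

(** Induction on the dimension of the face where x_s = k for all s >= m. For the step from m to m+1,
    exactness and telescoping leave only the boundary facets. Those in a direction s < m contribute
    0 because [a s] is constant there; x_m = 0 contributes 0 because [a m] vanishes; on x_m = k the
    factor [a m] is 1, which leaves the sum for m. *)
Lemma cup_sum (n k : nat) (a : nat -> {ffun 'I_n -> nat} -> 'F_2) (m : nat) :
  (m <= n)%N -> (0 < k)%N ->
  (forall (i : 'I_n) (x : {ffun 'I_n -> nat}), x i = 0%N -> a i x = 0) ->
  (forall (i : 'I_n) (x : {ffun 'I_n -> nat}), x i = k -> a i x = 1) ->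
  \sum_(x : {ffun 'I_n -> 'I_k.+1} | [forall s : 'I_n, if (s < m)%N then (x s < k)%N else x s == k :> nat])
    cup a m [ffun t => x t : nat] [set s : 'I_n | (s < m)%N] = 1.
Proof.
move=> mn k0 a0 a1; elim: m mn => [|m IH] mn.
  rewrite (big_pred1 [ffun=> ord_max]) // => x; apply/forallP/eqP => [h|-> s].
    by apply/ffunP => s; rewrite ffunE; apply/val_inj/eqP/h.
  by rewrite ffunE.
have [_ dcup] := cup_closed a m.
under eq_bigr => x _ do rewrite dcup.
rewrite /cobd exchange_big /=.
pose E := [set s : 'I_n | (s < m.+1)%N].
pose s0 : 'I_n := Ordinal mn.
(* The face condition with coordinate [s] released, as telescoping in direction [s] requires. *)
pose P (s : 'I_n) (x : {ffun 'I_n -> 'I_k.+1}) :=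
  [forall t : 'I_n, (t != s) ==> if (t < m.+1)%N then (x t < k)%N else x t == k :> nat].
have PE (s : 'I_n) (x : {ffun 'I_n -> 'I_k.+1}) : s \in E ->
    [forall t : 'I_n,
      if (t < m.+1)%N then (x t < k)%N else x t == k :> nat] =
    P s x && (x s < k)%N.
  rewrite inE => sm; apply/forallP/andP => [h|[/forallP h xs] t].
    by split; [apply/forallP => t; rewrite h implybT|have := h s; rewrite sm].
  by have := h t; case: eqP => [-> _|//]; rewrite sm.
have tel (s : 'I_n) : s \in E ->
    \sum_(x : {ffun 'I_n -> 'I_k.+1} |
        [forall t : 'I_n, if (t < m.+1)%N then (x t < k)%N else x t == k :> nat])
      (pcup a m (corner [ffun t => x t : nat] [set s]) (E :\ s) + pcup a m [ffun t => x t : nat] (E :\ s)) =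
    \sum_(x | P s x && (x s == k :> nat)) pcup a m [ffun t => x t : nat] (E :\ s) +
    \sum_(x | P s x && (x s == 0 :> nat)) pcup a m [ffun t => x t : nat] (E :\ s).
  move=> sE; rewrite (eq_bigl (fun x => P s x && (x s < k)%N)); last by move=> x; exact: PE.
  apply: (sum_telescope (fun x => pcup a m x (E :\ s))) => x y xy.
  by apply: eq_forallb => t; case: eqP => //= /eqP ts; rewrite xy.
(* No edge of such a facet runs in direction [s], so the boundary values of [a s] hold at all its
   corners. *)
have fc (s : 'I_n) (x : {ffun 'I_n -> 'I_k.+1}) (E' : {set 'I_n}) : E' \subset E :\ s ->
    corner [ffun t => x t : nat] E' s = x s.
  move=> sE'; rewrite !ffunE; case: (boolP (s \in E')) => [/(subsetP sE')|_]; last exact: addn0.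
  by rewrite !inE eqxx.
have s0E : s0 \in E by rewrite inE.
rewrite (bigD1 s0) //= [X in _ + X]big1 ?addr0 => [|s /andP[sE ss0]]; last first.
  have lt_s : (s < m)%N.
    by move: sE ss0; rewrite inE ltnS leq_eqVlt -(inj_eq val_inj) /= => /orP[->|].
  rewrite tel // !big1 ?addr0 // => x /andP[_ /eqP xs]; rewrite /pcup.
    by rewrite (cup_const (c := 0) lt_s) ?mul0r // => E' sE'; rewrite a0 // fc.
  by rewrite (cup_const (c := 1) lt_s) ?mul0r // => E' sE'; rewrite a1 // fc.
rewrite tel // [X in _ + X]big1 ?addr0 => [|x /andP[_ /eqP xs]]; last first.
  by rewrite /pcup [a m _](a0 s0) ?mulr0 // fc.
rewrite -[RHS](IH (ltnW mn)); apply: eq_big => [x|x /andP[_ /eqP xs]].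
  apply/andP/forallP => [[/forallP h /eqP xs] t|h].
    have := h t; rewrite -(inj_eq val_inj) /= ltnS leq_eqVlt.
    by case: eqP => [e _|_ //]; rewrite e ltnn; apply/eqP; rewrite (_ : t = s0) ?xs //; apply/val_inj.
  split; last by have := h s0; rewrite /= ltnn.
  apply/forallP => t; apply/implyP; rewrite -(inj_eq val_inj) /= => /negPf tm.
  by have := h t; rewrite ltnS [(t <= m)%N]leq_eqVlt tm.
rewrite /pcup [a m _](a1 s0) ?mulr1 ?fc //; congr cup.
by apply/setP => t; rewrite !inE ltnS [RHS]ltn_neqAle -(inj_eq val_inj).
Qed.

(** * Discrete Poincare-Miranda and Hex *)

Lemma poincare_miranda (n k : nat) (a : 'I_n -> {ffun 'I_n -> nat} -> bool) :
  (0 < k)%N ->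
  (forall i (x : {ffun _ -> nat}), x i = 0%N -> a i x = false) ->
  (forall i (x : {ffun _ -> nat}), x i = k -> a i x = true) ->
  exists K : {ffun 'I_n -> 'I_k}, forall i,
    exists E1 E2 : {set 'I_n},
      a i (corner [ffun t => K t : nat] E1) != a i (corner [ffun t => K t : nat] E2).
Proof.
move=> k0 a0 a1.
(* [cup] indexes its cochains by naturals, hence the extension by 0 past n. *)
pose b (m : nat) x : 'F_2 := if insub m is Some i then (a i x)%:R else 0.
have bE (i : 'I_n) x : b i x = (a i x)%:R by rewrite /b valK.
have := @cup_sum n k b n (leqnn n) k0.
have -> : [set s : 'I_n | (s < n)%N] = setT by apply/setP => s; rewrite !inE ltn_ord.
move=> H; have {H} : \sum_(x : {ffun 'I_n -> 'I_k.+1} | [forall s : 'I_n, (x s < k)%N])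
    cup b n [ffun t => x t : nat] setT = 1.
  rewrite -[RHS]H.
  - by apply: eq_bigl => x; apply: eq_forallb => s; rewrite ltn_ord.
  - by move=> i x /a0 e; rewrite bE e.
  - by move=> i x /a1 e; rewrite bE e.
(* If every cube had some [a i] constant on its corners, [cup_const] would kill every term of a sum
   equal to 1. *)
move=> H; apply: contrapT => nK.
have : 0 = 1 :> 'F_2; last by [].
rewrite -H big1 // => x /forallP xk.
pose K : {ffun 'I_n -> 'I_k} := [ffun s => Ordinal (xk s)].
have [i Ki] : exists i, forall E1 E2,
    a i (corner [ffun t => K t : nat] E1) = a i (corner [ffun t => K t : nat] E2).
  apply: contrapT => h; apply: nK; exists K => i.
  apply: contrapT => h'; apply: h; exists i => E1 E2.
  by apply/eqP; apply: contrapT => /negP h''; apply: h'; exists E1, E2.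
have eK : [ffun t => x t : nat] = [ffun t => K t : nat] by apply/ffunP => t; rewrite !ffunE.
apply: (@cup_const _ _ _ i (b i (corner [ffun t => x t : nat] set0))) => // E' _.
by rewrite !bE eK (Ki E' set0).
Qed.

(** Combinatorial substitute for intersecting closed cubes, which keeps Hex free of real numbers. *)
Definition touch (n k : nat) (K1 K2 : cube_index n k) :=
  [forall s, (K1 s <= (K2 s).+1)%N && (K2 s <= (K1 s).+1)%N].

Definition mono (n k : nat) (c : cube_index n k -> 'I_n) (i : 'I_n) : rel (cube_index n k) :=
  [rel K1 K2 | [&& touch K1 K2, c K1 == i & c K2 == i]].

Lemma hex (n k : nat) (c : cube_index n k -> 'I_n) : (0 < k)%N ->
  exists i (K0 K1 : cube_index n k),
    [/\ K0 i = 0%N :> nat, (K1 i).+1 = k, c K0 = i & connect (mono c i) K0 K1].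
Proof.
move=> k0; apply: contrapT => nhex.
pose A (i : 'I_n) :=
  [set K | [exists K0 : cube_index n k, [&& K0 i == 0 :> nat, c K0 == i & connect (mono c i) K0 K]]].
pose a i (x : {ffun 'I_n -> nat}) :=
  (x i != 0%N) && ~~ [exists K in A i, exists E, x == corner [ffun t => K t : nat] E].
have Ac i K : K \in A i -> c K = i.
  rewrite inE => /existsP[K0 /and3P[_ /eqP cK0 /connectP[p]]].
  elim: p K0 cK0 => [|K' p IH] K0 cK0 /=; first by move=> _ ->.
  by move=> /andP[/and3P[_ _ /eqP cK'] pp] eK; apply: (IH _ cK').
have [||K aK] := @poincare_miranda n k a k0.
- by move=> i x xi; rewrite /a xi.
- move=> i x xi; rewrite /a xi -lt0n k0 /=; apply/negP => /exists_inP[K KA /existsP[E /eqP xE]].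
  apply: nhex; have cK := Ac _ _ KA; move: KA; rewrite inE => /existsP[K0 /and3P[/eqP K00 /eqP cK0 con]].
  exists i, K0, K; split=> //; have := xi; rewrite xE !ffunE.
  by have := ltn_ord (K i); case: (i \in E) => /=; lia.
have corner_touch (K1 K2 : cube_index n k) E1 E2 :
    corner [ffun t => K1 t : nat] E1 = corner [ffun t => K2 t : nat] E2 -> touch K1 K2.
  move=> /ffunP e; apply/forallP => s; have := e s; rewrite !ffunE.
  by case: (s \in E1); case: (s \in E2) => /=; lia.
(* The colour of [K] gives the contradiction. If [K] is joined to the face, [a (c K)] is 0 at all
   its corners. Otherwise it is 1 at all of them: a corner on the face would make [K] a starting
   cube, and a corner shared with a cube of [A (c K)] would extend that chain to [K]. *)
have := aK (c K); case: (boolP (K \in A (c K))) => KA.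
  have z E : a (c K) (corner [ffun t => K t : nat] E) = false.
    apply/negbTE; rewrite negb_and; apply/orP; right; rewrite negbK.
    by apply/exists_inP; exists K => //; apply/existsP; exists E.
  by move=> [E1 [E2]]; rewrite !z.
have z E : a (c K) (corner [ffun t => K t : nat] E) = true.
  apply/andP; split; apply: contra KA.
    rewrite !ffunE addn_eq0 inE => /andP[K0 _]; apply/existsP; exists K.
    by rewrite K0 eqxx connect0.
  move=> /exists_inP[K' K'A /existsP[E' /eqP e]].
  have cK' := Ac _ _ K'A.
  move: K'A; rewrite !inE => /existsP[K0 /and3P[K00 cK0 con]].
  apply/existsP; exists K0; rewrite K00 cK0 /=; apply: connect_trans con _; apply: connect1.
  rewrite /mono /= (corner_touch _ _ _ _ (esym e)).
  by rewrite cK' eqxx.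
by move=> [E1 [E2]]; rewrite !z.
Qed.

(** * Boxes and residue cells in the integer lattice *)

Definition box (n : nat) (b : Zpt n) (L : nat) : seq (Zpt n) :=
  [seq [ffun j => b j + (f j : nat)%:Z] | f : {ffun 'I_n.-1 -> 'I_L}].

Lemma mem_box n (b z : Zpt n) L :
  (z \in box b L) = [forall j, (b j <= z j) && (z j < b j + L%:Z)].
Proof.
apply/mapP/forallP => [[f _ ->] j|h].
  rewrite !ffunE; case: (f j) => m /= mL; lia.
have hj j : (absz (z j - b j) < L)%N by have := h j; lia.
exists [ffun j => Ordinal (hj j)]; first by rewrite mem_enum.
by apply/ffunP => j; rewrite !ffunE /=; have := h j; lia.
Qed.

Lemma uniq_box n (b : Zpt n) L : uniq (box b L).
Proof.
rewrite map_inj_uniq ?enum_uniq // => f g /ffunP e; apply/ffunP => j; apply/val_inj.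
by have := e j; rewrite !ffunE /=; lia.
Qed.

Lemma size_box n (b : Zpt n) L : size (box b L) = (L ^ n.-1)%N.
Proof. by rewrite size_map -cardE card_ffun !card_ord. Qed.

Definition toward (u v : int) : int := if u < v then u + 1 else if v < u then u - 1 else u.

Lemma toward_box (u v t L : int) : t <= u < t + L -> t <= v < t + L ->
  t <= toward u v < t + L.
Proof. by rewrite /toward; case: ifP => ?; [|case: ifP => ?]; lia. Qed.

Lemma toward_dist (u v : int) (d : nat) : `|v - u| <= d.+1%:Z ->
  `|v - toward u v| <= d%:Z.
Proof. by rewrite /toward; case: ifP => ?; [|case: ifP => ?]; lia. Qed.

Lemma toward1 (u v : int) : `|u - toward u v| <= 1.
Proof. by rewrite /toward; case: ifP => ?; [|case: ifP => ?]; lia. Qed.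

(** Moving every coordinate one unit toward the target at once stays in the box and lowers the bound
    [d] on the sup distance by one. *)
Lemma box_connected n (b : Zpt n) L : one_connected (box b L).
Proof.
move=> x y xB yB.
have [d dP] : exists d : nat, forall j, `|y j - x j| <= d%:Z.
  exists (\sum_j absz (y j - x j)%R)%N => j.
  by rewrite (bigD1 j) //= -abszE lez_nat leq_addr.
elim: d x xB dP => [|d IH] x xB dP.
  exists [::]; split=> //=; apply/ffunP => j.
  by have := dP j; rewrite normr_le0 subr_eq0 => /eqP.
pose x' : Zpt n := [ffun j => toward (x j) (y j)].
have x'B : x' \in box b L.
  move: xB yB; rewrite !mem_box => /forallP xB /forallP yB; apply/forallP => j.
  by rewrite ffunE; apply: toward_box.
have [//|j|p [pp pl pa]] := IH x'; first by rewrite ffunE; apply: toward_dist.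
exists (x' :: p); split=> //=; last by rewrite x'B.
by rewrite pp andbT; apply/forallP => j; rewrite ffunE toward1.
Qed.

(* [z] avoids the interval [c w, (c + 1) w) modulo [n w]. *)
Definition far (n w : nat) (c : nat) (z : int) := (w%:Z <= ((z - (c * w)%:Z)%R %% (n * w)%:Z)%Z).

(** Pigeonhole: the n forbidden intervals are disjoint modulo nw, so each of the n-1 coordinates
    rules out at most one colour. *)
Lemma far_color (n w : nat) (z : Zpt n) : (0 < n)%N -> (0 < w)%N ->
  exists c : 'I_n, forall j, far n w c (z j).
Proof.
move=> n0 w0; apply: contrapT => nc.
have L0 : (n * w)%:Z != 0 by lia.
have bad (c : 'I_n) : exists j, ~~ far n w c (z j).
  by apply: contrapT => h; apply: nc; exists c => j; apply: contrapT => /negP h'; apply: h; exists j.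
have [f fP] := choice bad.
suff /leq_card : injective f by rewrite !card_ord; lia.
move=> c c' ef; have := fP c; have := fP c'; rewrite -{}ef; move: (z (f c)) => {bad fP f}x.
rewrite /far -!ltNge => h' h; apply/val_inj => /=.
move: (nat_of_ord c) (nat_of_ord c') (ltn_ord c) (ltn_ord c') h h' => {}c {}c' cn c'n.
have := divz_eq (x - (c * w)%:Z) (n * w)%:Z; have := divz_eq (x - (c' * w)%:Z) (n * w)%:Z.
have := modz_ge0 (x - (c * w)%:Z) L0; have := modz_ge0 (x - (c' * w)%:Z) L0.
move: (modz _ _) (modz (x - (c * w)%:Z) _) (divz _ _) (divz (x - (c * w)%:Z) _).
move=> r' r q' q r'0 r0 e' e lr lr'.
(* Both remainders are below w, so this multiple of w is 0; then n divides c' - c, whose absolute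
   value is below n. *)
have e1 : (c'%:Z - c%:Z - (q - q') * n%:Z) * w%:Z = r - r' by rewrite !PoszM in e e'; nia.
have e2 : c'%:Z - c%:Z = (q - q') * n%:Z by nia.
move: (q - q') e2 => d e2.
have /or3P[d0|d0|/eqP d0] : [|| 1 <= d, d <= -1 | d == 0] by lia.
- by have : n%:Z <= d * n%:Z; [nia|lia].
- by have : d * n%:Z <= - n%:Z; [nia|lia].
- by move: e2; rewrite d0 mul0r; lia.
Qed.

(** Remainders lie in [w, nw), so points of different cells differ by at least w + 1. *)
Lemma far_cell (n w c : nat) (x y : int) : (0 < n)%N -> (0 < w)%N ->
  far n w c x -> far n w c y -> `|x - y| <= w%:Z ->
  ((x - (c * w)%:Z)%R %/ (n * w)%:Z)%Z = ((y - (c * w)%:Z)%R %/ (n * w)%:Z)%Z.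
Proof.
rewrite /far => n0 w0.
have L0 : (0 < (n * w)%:Z) by lia.
have := divz_eq (x - (c * w)%:Z) (n * w)%:Z; have := divz_eq (y - (c * w)%:Z) (n * w)%:Z.
have := ltz_pmod (x - (c * w)%:Z) L0; have := ltz_pmod (y - (c * w)%:Z) L0.
move: (modz _ _) (modz (x - (c * w)%:Z) _) (divz _ _) (divz (x - (c * w)%:Z) _) => r' r q' q.
move: (c * w)%N (n * w)%N L0 => cw L L0 *; nia.
Qed.

(* Connectedness of unions of cubes *)
From mathcomp Require Import all_classical all_reals all_analysis.
Import numFieldTopology.Exports numFieldNormedType.Exports.
Local Open Scope classical_set_scope.
Local Open Scope ring_scope.

(** The cube is star-shaped about its lowest corner [z0]. *)
Lemma cube_connected (R : realType) (n k : nat) (K : cube_index n k) : connected (@cube R n k K).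
Proof.
pose z0 : 'M[R]_(1, n) := \row_s ((K s)%:R / k%:R).
have z0K : @cube R n k K z0.
  by move=> s; rewrite mxE lexx; split=> //; rewrite ler_wpM2r ?invr_ge0 // ler_nat.
pose seg (z : 'M[R]_(1, n)) := (fun t : R => z0 + t *: (z - z0)) @` `[0, 1]%classic.
have -> : @cube R n k K = \bigcup_(z in @cube R n k K) seg z.
  apply/seteqP; split=> [z Kz|z [u Ku [t /=]]].
    by exists z => //; exists 1; rewrite /= ?in_itv /= ?ler01 ?lexx // scale1r addrC subrK.
  rewrite in_itv /= => /andP[t0 t1] <- s; have [l0 l1] := z0K s; have [u0 u1] := Ku s.
  rewrite !mxE; rewrite mxE in l0 l1.
  by move: (_ / _) (_ / _) (u _ _) l0 l1 u0 u1 => *; split; nra.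
apply: bigcup_connected => [|z _].
  by exists z0 => z _; exists 0; rewrite /= ?in_itv /= ?ler01 ?lexx // scale0r addr0.
apply: connected_continuous_connected; first exact: segment_connected.
apply: continuous_subspaceT => t.
by apply: cvgD; [exact: cvg_cst|apply: cvgZr_tmp; exact: cvg_id].
Qed.

Lemma touch_cube (R : realType) (n k : nat) (K1 K2 : cube_index n k) :
  touch K1 K2 -> @cube R n k K1 `&` @cube R n k K2 !=set0.
Proof.
move=> /forallP tK; exists (\row_s ((maxn (K1 s) (K2 s))%:R / k%:R)).
split=> s; rewrite mxE; have := tK s => /andP[h1 h2]; split; rewrite ler_wpM2r ?invr_ge0 // ler_nat; lia.
Qed.

Lemma path_cubes_connected (R : realType) (n k : nat) (e : rel (cube_index n k)) K0 p :
  subrel e (@touch n k) -> path e K0 p ->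
  connected [set z | exists2 K, K \in K0 :: p & @cube R n k K z].
Proof.
move=> et; elim: p K0 => [|K' p IH] K0.
  move=> _; rewrite (_ : mkset _ = @cube R n k K0); first exact: cube_connected.
  by apply/seteqP; split=> [z [K]|z Kz]; [rewrite inE => /eqP ->|exists K0; rewrite ?inE].
rewrite [path _ _ _]/= => /andP[/et/(touch_cube R) [z [z0 z']] /IH cp].
rewrite (_ : mkset _ = @cube R n k K0 `|` [set z | exists2 K, K \in K' :: p & @cube R n k K z]).
  apply: connectedU => //; last exact: cube_connected.
  by exists z; split=> //; exists K' => //; rewrite inE eqxx.
apply/seteqP; split=> [u [K]|u [Ku|[K Kp Ku]]].
- by rewrite inE => /predU1P[->|Kp] Ku; [left|right; exists K].
- by exists K0; rewrite // inE eqxx.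
- by exists K; rewrite // inE Kp orbT.
Qed.

(** The component is the union, over all paths from [K0], of connected sets that all contain the
    cube [K0]. *)
Lemma component_connected (R : realType) (n k : nat) (e : rel (cube_index n k)) K0 :
  subrel e (@touch n k) -> connected (@union_cubes R n k [set K | connect e K0 K]).
Proof.
move=> et.
rewrite (_ : union_cubes _ = \bigcup_(p in [set p | path e K0 p])
   [set z | exists2 K, K \in K0 :: p & @cube R n k K z]).
  apply: bigcup_connected => [|p pp]; last exact: path_cubes_connected et pp.
  have [z [Kz _]] : @cube R n k K0 `&` @cube R n k K0 !=set0.
    by apply: touch_cube; apply/forallP => s; rewrite leqnSn.
  by exists z => p _; exists K0; rewrite // inE eqxx.
apply/seteqP; split=> [z [K []]|z [p pp [K Kp Kz]]].
  by rewrite inE => /connectP[p pp ->] Kz; exists p => //; exists (last K0 p); rewrite ?mem_last.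
by exists K; split=> //; rewrite inE; apply: path_connect pp _ Kp.
Qed.

(** * Variation of F between touching cubes, and conclusion *)

Lemma touch_dist (R : realType) (n m k : nat) (F : cube_index n k -> Zpt n) :
  (m <= n - 1)%N ->
  (forall K1 K2 : cube_index n k, @meet_dim_ge R n k m K1 K2 -> linf_le1 (F K1) (F K2)) ->
  forall (K1 K2 : cube_index n k) j, touch K1 K2 -> `|F K1 j - F K2 j| <= n%:Z.
Proof.
move=> mn FL K1 K2 j /forallP tK.
(* Exchange the coordinates one at a time: consecutive hybrids touch and agree in at least n - 1 >=
   m coordinates, so each of the n exchanges moves F by at most 1. *)
pose h t : cube_index n k := [ffun s : 'I_n => if (s < t)%N then K2 s else K1 s].
have hn : h n = K2 by apply/ffunP => s; rewrite ffunE ltn_ord.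
suff H t : (t <= n)%N -> `|F K1 j - F (h t) j| <= t%:Z by rewrite -{1}hn H.
elim: t => [_|t IH tn].
  by rewrite (_ : h 0%N = K1) ?subrr //; apply/ffunP => s; rewrite ffunE ltn0.
have := IH (ltnW tn).
suff /forallP/(_ j) : linf_le1 (F (h t)) (F (h t.+1)).
  by move: (F K1 j) (F (h t) j) (F (h t.+1) j) => *; lia.
apply: FL; split.
  apply: touch_cube; apply/forallP => s; rewrite !ffunE; have := tK s.
  by case: ltngtP => ?; case: ltngtP => ?; lia.
apply: leq_trans mn _.
have <- : #|predC1 (Ordinal tn)| = (n - 1)%N by rewrite cardC1 card_ord subn1.
apply/subset_leq_card/fintype.subsetP => s; rewrite !inE -(inj_eq val_inj) /= !ffunE => st.
by rewrite ltnS [(s <= t)%N]leq_eqVlt (negPf st).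
Qed.

Theorem theoremA (R : realType) (n m : nat) (hn : (0 < n)%N) (hm : (m <= n - 1)%N) :
  exists C : nat, (0 < C)%N /\
    forall (k : nat) (F : cube_index n k -> Zpt n),
      (0 < k)%N ->
      (forall K1 K2 : cube_index n k, @meet_dim_ge R n k m K1 K2 -> linf_le1 (F K1) (F K2)) ->
      exists (P : seq (Zpt n)) (S : {set cube_index n k}),
        [/\ uniq P, one_connected P, (size P <= C)%N,
            (forall K, K \in S -> F K \in P)
          & connects_opposite_faces (@union_cubes R n k S)].
Proof.
exists ((n * n) ^ n.-1)%N; split; first by rewrite expn_gt0 muln_gt0 hn.
move=> k F k0 FL.
(* The interval width is w = n, the bound from [touch_dist]; hence the period n * n and the box side
   n * n. *)
have [c cP] := choice (fun K => far_color (F K) hn hn).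
have [i [K0 [K1 [K00 K1k cK0 con]]]] := hex c k0.
pose quo K j := ((F K j - (i * n)%:Z)%R %/ (n * n)%:Z)%Z.
have quoE K j : connect (mono c i) K0 K -> far n n i (F K j) /\ quo K j = quo K0 j.
  (* Each edge of the chain preserves the cell by [far_cell]; the induction varies the starting
     cube. *)
  move=> /connectP[p pp ->] {con}; elim: p (K0) cK0 pp => [|K' p IH] L0 cL0 /=.
    by rewrite -cL0.
  move=> /andP[/and3P[t _ /eqP cK'] /(IH _ cK')[fl ->]]; split=> //.
  apply/esym/far_cell => //; [by rewrite -cL0|by rewrite -cK'|exact: touch_dist hm FL _ _ _ t].
exists (@box n [ffun j => quo K0 j * (n * n)%:Z + (i * n)%:Z] (n * n)).
exists [set K | connect (mono c i) K0 K]%SET; split.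
- exact: uniq_box.
- exact: box_connected.
- by rewrite size_box.
- move=> K; rewrite inE mem_box => cK; apply/forallP => j; rewrite ffunE.
  have [_ <-] := quoE K j cK; rewrite /quo.
  have L0 : (0 < (n * n)%:Z) by rewrite ltz_nat muln_gt0 hn.
  have := divz_eq (F K j - (i * n)%:Z) (n * n)%:Z.
  have := ltz_pmod (F K j - (i * n)%:Z) L0; have := modz_ge0 (F K j - (i * n)%:Z) (lt0r_neq0 L0).
  move: (divz _ _) (modz _ _) => q r; move: (q * _) (F K j) => u x; lia.
- split; first by apply: component_connected => K K' /and3P[].
  have k0' : k%:R != 0 :> R by rewrite pnatr_eq0 -lt0n.
  exists i; split.
    (* The lowest corner of [K0] lies on the face z_i = 0, the highest corner of [K1] on z_i = 1. *)
    exists (\row_s ((K0 s)%:R / k%:R)); split; last by rewrite mxE K00 mul0r.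
    exists K0; split; first by rewrite inE connect0.
    by move=> s; rewrite mxE lexx; split=> //; rewrite ler_wpM2r ?invr_ge0 // ler_nat.
  exists (\row_s ((K1 s).+1%:R / k%:R)); split; last by rewrite mxE K1k divff.
  exists K1; split; first by rewrite inE.
  by move=> s; rewrite mxE lexx; split=> //; rewrite ler_wpM2r ?invr_ge0 // ler_nat.
Qed.
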